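(* Let $L$ be a logic on the propositional language $\mathcal{L}$ with class of models $\Omega_L$, and suppose that for all $\varphi,\psi\in\mathcal{L}$ and all $v\in\Omega_L$: - if $\vdash_L\varphi$ then $v\models_L\varphi$ (soundness); - $v\models_L\varphi\leftrightarrow\psi$ iff ($v\models_L\varphi\Leftrightarrow v\models_L\psi$); - $v\models_L\varphi\wedge\psi$ iff $v\models_L\varphi$ and $v\models_L\psi$. Then for every $L$-possibility distribution $\pi:\Omega_L\to[0,1]$, the mapping $f_1(\pi):\mathcal{L}\to[0,1]$ defined by $f_1(\pi)(\varphi)=1-\sup\{\pi(v): v\not\models_L\varphi\}$ is an $L$-necessity function.
   Context: $\mathcal{L}$ is a classical propositional language, built from a list of propositional variables and the connectives $\neg,\wedge,\vee,\to,\leftrightarrow$. A logic $L$ on $\mathcal{L}$ is given by a (possibly non-classical) consequence relation $\vdash_L$; $\vdash_L\varphi$ means that $\varphi$ is a theorem of $L$. $\vdash_L\varphi\leftrightarrow\psi$ is a shorthand for ''$\vdash_L\varphi\to\psi$ and $\vdash_L\psi\to\varphi$''; likewise $v\models_L\varphi\leftrightarrow\psi$ stands for ''$v\models_L\varphi\to\psi$ and $v\models_L\psi\to\varphi$''. $\Omega_L$ is the class of $L$-models and $v\models_L\varphi$ means that $v\in\Omega_L$ satisfies $\varphi$. An $L$-possibility distribution is a mapping $\pi:\Omega_L\to[0,1]$. Convention: $\sup\emptyset=0$. An $L$-necessity function is a mapping $N:\mathcal{L}\to[0,1]$ such that for all $\varphi,\psi$: (Taut) if $\vdash_L\varphi$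 then $N(\varphi)=1$; (Eq) if $\vdash_L\varphi\leftrightarrow\psi$ then $N(\varphi)=N(\psi)$; (Conj) $N(\varphi\wedge\psi)=\min(N(\varphi),N(\psi))$. *)

(* Defs.v *)
From mathcomp Require Import all_boot all_order all_algebra.
From mathcomp Require Import all_classical all_reals.

Set Implicit Arguments.
Unset Strict Implicit.
Unset Printing Implicit Defensive.

Import Order.TTheory GRing.Theory Num.Theory.

Local Open Scope classical_set_scope.
Local Open Scope ring_scope.

Inductive formula (Var : Type) : Type :=
| Atom of Var
| Neg of formula Var
| And of formula Var & formula Var
| Or of formula Var & formula Var
| Imp of formula Var & formula Var
| Iff of formula Var & formula Var.

(* No condition (reflexivity, monotonicity, cut, soundness, ...) is imposed:
   the logic may be non-classical, and whatever is needed of it is a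
   hypothesis of the theorem where it is used. *)
Record logic (Var : Type) := Logic {
  conseq : set (formula Var) -> formula Var -> Prop;
  model : Type;
  satisfies : model -> formula Var -> Prop
}.

Arguments satisfies {Var} l v phi.

Section Notions.
Context {R : realType} {Var : Type} (L : logic Var).
Implicit Types (phi psi : formula Var) (v : model L).

Definition provable phi : Prop := conseq L set0 phi.

(* Provability and satisfaction of a biconditional abbreviate those of the two
   implications; the connective Iff itself is not involved. *)
Definition provable_iff phi psi : Prop :=
  provable (Imp phi psi) /\ provable (Imp psi phi).

Definition satisfies_iff v phi psi : Prop :=
  satisfies L v (Imp phi psi) /\ satisfies L v (Imp psi phi).

Definition possibility_distribution (pi : model L -> R) : Prop :=
  forall v, 0 <= pi v <= 1.

Definition necessity_function (N : formula Var -> R) : Prop :=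
  [/\ forall phi, 0 <= N phi <= 1,
      forall phi, provable phi -> N phi = 1,
      forall phi psi, provable_iff phi psi -> N phi = N psi &
      forall phi psi, N (And phi psi) = Num.min (N phi) (N psi)].

(* The library's sup of the empty set is 0, as the convention requires. *)
Definition f1 (pi : model L -> R) phi : R :=
  1 - sup [set pi v | v in [set v | ~ satisfies L v phi]].

End Notions.

(* Main.v *)
Require Import Defs.
From mathcomp Require Import all_boot all_order all_algebra.
From mathcomp Require Import all_classical all_reals.

Import Order.TTheory GRing.Theory Num.Theory.

Local Open Scope classical_set_scope.
Local Open Scope ring_scope.

(** [f1 pi phi] is 1 minus the supremum of [pi] over the countermodels of [phi]. By soundness a
    theorem has no countermodel, and provably equivalent formulas have the same ones. The
    countermodels of a conjunction are the union of those of its conjuncts; [ge0_sup_setU] turns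
    this union into a maximum of suprema, and subtraction from 1 turns the maximum into a
    minimum. *)

(* The bound must be nonnegative because of the junk value sup set0 = 0. *)
Lemma ge0_ge_sup (R : realType) (S : set R) (x : R) :
  0 <= x -> ubound S x -> sup S <= x.
Proof.
move=> x0 Sx; have [->|S0] := eqVneq S set0; first by rewrite sup0.
by apply: ge_sup => //; apply/set0P.
Qed.

Lemma ge0_sup (R : realType) (S : set R) :
  has_ubound S -> (forall x, S x -> 0 <= x) -> 0 <= sup S.
Proof.
move=> ubS S_ge0; have [->|/set0P[x Sx]] := eqVneq S set0.
  by rewrite sup0.
by apply: le_trans (S_ge0 _ Sx) _; exact: ub_le_sup.
Qed.

(** Nonnegativity makes the default value 0 of [sup set0] neutral for [Num.max], so the equality
    survives when [A] or [B] is empty, as happens for a formula true in every model. *)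
Lemma ge0_sup_setU (R : realType) (A B : set R) :
  has_ubound (A `|` B) -> (forall x, (A `|` B) x -> 0 <= x) ->
  sup (A `|` B) = Num.max (sup A) (sup B).
Proof.
move=> ubAB AB_ge0.
have ubA : has_ubound A by apply: subset_has_ubound ubAB; exact: subsetUl.
have ubB : has_ubound B by apply: subset_has_ubound ubAB; exact: subsetUr.
have A_ge0 : 0 <= sup A by apply: ge0_sup => // x Ax; apply: AB_ge0; left.
have B_ge0 : 0 <= sup B by apply: ge0_sup => // x Bx; apply: AB_ge0; right.
have AB_sup_ge0 : 0 <= sup (A `|` B) by exact: ge0_sup.
apply/le_anti/andP; split.
  apply: ge0_ge_sup; first by rewrite le_max A_ge0.
  by move=> x [Ax|Bx]; rewrite le_max; apply/orP; [left|right];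
    exact: ub_le_sup.
rewrite ge_max; apply/andP; split; apply: ge0_ge_sup => // x ?.
  by apply: ub_le_sup => //; left.
by apply: ub_le_sup => //; right.
Qed.

Theorem proposition12 (R : realType) (Var : Type) (L : logic Var)
    (soundness : forall (phi : formula Var) (v : model L),
      provable L phi -> satisfies L v phi)
    (sat_iffE : forall (phi psi : formula Var) (v : model L),
      satisfies_iff v phi psi <-> (satisfies L v phi <-> satisfies L v psi))
    (sat_andE : forall (phi psi : formula Var) (v : model L),
      satisfies L v (And phi psi) <-> satisfies L v phi /\ satisfies L v psi)
    (pi : model L -> R) (pi_distr : possibility_distribution pi) :
  necessity_function L (f1 pi).
Proof.
have pi_ge0 (A : set (model L)) x : (pi @` A) x -> 0 <= x.
  by case=> v _ <-; have /andP[] := pi_distr v.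
have pi_ub1 (A : set (model L)) : ubound (pi @` A) 1.
  by move=> _ [v _ <-]; have /andP[] := pi_distr v.
have pi_ub (A : set (model L)) : has_ubound (pi @` A) by exists 1.
split.
(* The two bounds on 1 minus the supremum become: the supremum is at most 1, and it is
   nonnegative. *)
- move=> phi; rewrite /f1 subr_ge0 lerBlDr lerDl.
  by rewrite ge0_ge_sup ?ge0_sup//; exact: pi_ge0.
- move=> phi phi_thm; rewrite /f1.
  have -> : [set v | ~ satisfies L v phi] = set0.
    by apply/seteqP; split=> v //=; apply; exact: soundness.
  by rewrite image_set0 sup0 subr0.
- move=> phi psi [phi_psi psi_phi]; rewrite /f1.
  have sat_eq v : satisfies L v phi <-> satisfies L v psi.
    (* Soundness makes both provable implications true at [v], which [sat_iffE] reads as equivalence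
       of truth values. *)
    by apply/sat_iffE; split; exact: soundness.
  congr (1 - sup (pi @` _)).
  by apply/seteqP; split=> v /= + /sat_eq.
- move=> phi psi; rewrite /f1.
  have -> : [set v | ~ satisfies L v (And phi psi)] =
      [set v | ~ satisfies L v phi] `|` [set v | ~ satisfies L v psi].
    (* De Morgan is used classically in the metatheory, on satisfaction rather than inside [L]. *)
    by apply/seteqP; split=> v /=; rewrite sat_andE not_andP.
  rewrite image_setU ge0_sup_setU -?image_setU//; last exact: pi_ge0.
  by rewrite oppr_max addr_minr.
Qed.
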